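(* Let $X$ be a complex Banach space and let $A:D(A)\to X$ be the infinitesimal generator of a $C_0$-semigroup $T=\{T(t)\}_{t\ge 0}$ of bounded linear operators of $X$. If the Cauchy problem $\dot u=Au$ is hyperbolic (that is, $\sigma(T(1))\cap S^1=\emptyset$, where $S^1$ is the complex unit circle), then the problem has the L-shadowing property (that is, $T$ has the L-shadowing property). Conversely, if the problem has the L-shadowing property and $\dim(X)<\infty$, then the problem is hyperbolic.
   Context: A semiflow of a metric space $(X,d)$ is a family $T=\{T(t):X\to X\}_{t\ge0}$ of continuous maps with $T(0)=I$ and $T(s+t)=T(s)\circ T(t)$ for all $s,t\ge0$. A semigroup of linear operators of a Banach space $X$ is a semiflow $T$ of $X$ such that each $T(t)$ is a bounded linear operator; it is a $C_0$-semigroup if $\lim_{t\to0}\|T(t)x-x\|=0$ for all $x\in X$. Its infinitesimal generator $A$ has domain $D(A)=\{x\in X:\lim_{t\to0}\frac{T(t)x-x}{t}\text{ exists}\}$ and $Ax$ is this limit (limits as $t\to 0^+$). Given $\delta,R>0$, a sequence $(x_i,t_i)_{i\ge0}\subset X\times(0,\infty)$ is a $(\delta,R)$-pseudo orbit of $T$ if $t_i\ge R$ and $d(T(t_i)x_i,x_{i+1})<\delta$ for all $i\ge0$. Put $\hat t_0=0$ and $\hat t_i=\sum_{j=0}^{i-1}t_j$ for $i>0$, and write $x_0*t=T(t-\hat t_i)x_i$ for $i\ge0$ and $\hat t_i\le t<\hat t_{i+1}$. A semiflow $T$ has the L-shadowing property if for every $\epsilon>0$ there are $\delta,R>0$ such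 that for every $(\delta,R)$-pseudo orbit $(x_i,t_i)_{i\ge0}$ of $T$ satisfying $\lim_{i\to\infty}d(T(t_i)x_i,x_{i+1})=0$ there are $x\in X$ and an increasing homeomorphism $h:[0,\infty)\to[0,\infty)$ such that $d(T(h(t))x,x_0*t)<\epsilon$ for all $t\ge0$ and $\lim_{t\to\infty}d(T(t)x,x_0*t)=0$. On a Banach space, $d(x,y)=\|x-y\|$. *)

(* Defs.v *)
From HB Require Import structures.
From mathcomp Require Import all_boot all_order all_algebra.
From mathcomp Require Import all_classical all_reals all_analysis.
From mathcomp Require Import complex.

Set Implicit Arguments.
Unset Strict Implicit.
Unset Printing Implicit Defensive.

Import Order.TTheory GRing.Theory Num.Theory.
Import numFieldNormedType.Exports.

Local Open Scope ring_scope.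
Local Open Scope complex_scope.
Local Open Scope classical_set_scope.

(* The norm of a normedModType over R[i] is R[i]-valued (real and nonnegative);
   [nrm] is the same norm, read in R. *)
Definition nrm {R : realType} {X : normedModType R[i]} (x : X) : R :=
  complex.Re `|x|.

Definition ndist {R : realType} {X : normedModType R[i]} (x y : X) : R :=
  nrm (x - y).

(* Families indexed by [0, +oo[ are functions on R; their values at negative
   times are irrelevant. *)
Definition semiflow {R : realType} {X : topologicalType} (T : R -> X -> X) :=
  [/\ forall t, 0 <= t -> continuous (T t),
      forall x, T 0 x = x &
      forall s t x, 0 <= s -> 0 <= t -> T (s + t) x = T s (T t x)].

Definition bounded_linear {R : realType} {X : normedModType R[i]}
    (f : X -> X) :=
  linear f /\ exists M : R, forall x, nrm (f x) <= M * nrm x.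

Definition operator_semigroup {R : realType} {X : normedModType R[i]}
    (T : R -> X -> X) :=
  semiflow T /\ forall t, 0 <= t -> bounded_linear (T t).

Definition C0_semigroup {R : realType} {X : normedModType R[i]}
    (T : R -> X -> X) :=
  operator_semigroup T /\
  forall x, ndist (T t x) x @[t --> (0 : R)^'+] --> (0 : R).

Definition difference_quotient {R : realType} {X : normedModType R[i]}
    (T : R -> X -> X) (x : X) (t : R) : X :=
  (t^-1)%:C *: (T t x - x).

Definition infinitesimal_generator {R : realType} {X : normedModType R[i]}
    (T : R -> X -> X) (DA : set X) (A : DA -> X) :=
  DA = [set x | cvg (difference_quotient T x t @[t --> (0 : R)^'+])] /\
  forall u : DA,
    difference_quotient T (\val u) t @[t --> (0 : R)^'+] --> A u.

Definition resolvent_set {R : realType} {X : normedModType R[i]}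
    (f : X -> X) : set R[i] :=
  [set l | exists S : X -> X,
    [/\ bounded_linear S,
        forall x, S (f x - l *: x) = x &
        forall x, f (S x) - l *: S x = x]].

Definition spectrum {R : realType} {X : normedModType R[i]}
    (f : X -> X) : set R[i] := ~` resolvent_set f.

Definition unit_circle {R : realType} : set R[i] := [set z | `|z| = 1].

Definition hyperbolic {R : realType} {X : normedModType R[i]}
    (T : R -> X -> X) :=
  spectrum (T 1) `&` unit_circle = set0.

Definition pseudo_orbit {R : realType} {X : Type} (d : X -> X -> R)
    (T : R -> X -> X) (delta r : R) (x_ : nat -> X) (t_ : nat -> R) :=
  forall i, [/\ 0 < t_ i, r <= t_ i & d (T (t_ i) (x_ i)) (x_ i.+1) < delta].

Definition hat_time {R : realType} (t_ : nat -> R) (i : nat) : R :=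
  \sum_(0 <= j < i) t_ j.

(* [star T x_ t_ t] is x_0 * t. The index i is unique when the t_ j are
   positive, and exists for all t >= 0 when they are bounded away from 0; the
   default index 0 only serves outside that case. *)
Definition star {R : realType} {X : Type} (T : R -> X -> X)
    (x_ : nat -> X) (t_ : nat -> R) (t : R) : X :=
  let i := xget 0%N [set i : nat | hat_time t_ i <= t < hat_time t_ i.+1] in
  T (t - hat_time t_ i) (x_ i).

Definition increasing_homeomorphism {R : realType} (h : R -> R) :=
  {in `[0, +oo[ &, {homo h : s t / s < t}} /\
  exists g : R -> R,
    [/\ {homo h : t / 0 <= t}, {homo g : t / 0 <= t},
        {in `[0, +oo[, cancel h g}, {in `[0, +oo[, cancel g h} &
        {within `[0, +oo[, continuous h} /\ {within `[0, +oo[, continuous g}].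

Definition L_shadowing {R : realType} {X : Type} (d : X -> X -> R)
    (T : R -> X -> X) :=
  forall eps : R, 0 < eps ->
  exists delta r : R, [/\ 0 < delta, 0 < r &
    forall (x_ : nat -> X) (t_ : nat -> R),
      pseudo_orbit d T delta r x_ t_ ->
      d (T (t_ i) (x_ i)) (x_ i.+1) @[i --> \oo] --> (0 : R) ->
      exists (x : X) (h : R -> R),
        [/\ increasing_homeomorphism h,
            forall t, 0 <= t -> d (T (h t) x) (star T x_ t_ t) < eps &
            d (T t x) (star T x_ t_ t) @[t --> +oo] --> (0 : R)]].

Definition finite_dimensional {K : fieldType} (X : lmodType K) :=
  exists (n : nat) (e : 'I_n -> X),
    forall x, exists c : 'I_n -> K, x = \sum_(i < n) c i *: e i.

(* Main.v *)
Require Import Defs.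
From HB Require Import structures.
From mathcomp Require Import all_boot all_order all_algebra.
From mathcomp Require Import all_classical all_reals all_analysis.
From mathcomp Require Import complex.
From mathcomp Require Import ring lra.

Set Implicit Arguments.
Unset Strict Implicit.
Unset Printing Implicit Defensive.

Import Order.TTheory GRing.Theory Num.Theory.
Import numFieldNormedType.Exports.

Local Open Scope ring_scope.
Local Open Scope complex_scope.
Local Open Scope classical_set_scope.

(* Hyperbolic implies shadowing. No Riesz projection is needed. For |l| = 1 and
   w_m = T(2^m) put D_m(l) = l w_m (w_m - l)^-2. A partial fraction identity
   gives D_(m+1)(l^2) = (D_m(l) + D_m(-l)) / 4, so compactness of the circle
   yields |D_m(1)| = O(2^-m). Choose m with |w V| <= 1/8, where w = w_m and
   V = (w - 1)^-2. For a sequence F (with F_(-1) = 0),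
   z_n = V F_(n-1) - w V F_n satisfies
   z_(n+1) - w z_n = F_n - w V (F_(n+1) + F_(n-1) - 2 F_n), so a Neumann series
   solves z_(n+1) = w z_n + E_n with z bounded by a multiple of sup |E|, and
   z -> 0 when E -> 0. Sampling a pseudo orbit with time gaps at least 2^m at
   the multiples of 2^m turns it into such an inhomogeneous recurrence, and the
   reparametrization h can be taken to be the identity.

   Converse. If T(1) v = l v with |l| = 1, a pseudo orbit l^(iN) b_i v with b_i
   a small multiple of the harmonic series has vanishing jumps. An orbit
   asymptotic to it would, after dividing by l^(iN) and projecting by a
   polynomial in T(N), be a fixed vector asymptotic to b_i v, although b_i is
   unbounded. *)

(** * The real-valued norm, linear maps and bounded operators *)

Section Norm.
Context {R : realType} {X : normedModType R[i]}.
Implicit Types (x y z : X) (c : R[i]).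

Lemma nrmC x : (nrm x)%:C = `|x|.
Proof. by rewrite /nrm RRe_real. Qed.

Lemma nrm_ge0 x : 0 <= nrm x.
Proof. by rewrite -ler0c nrmC. Qed.

Lemma nrm0 : nrm (0 : X) = 0.
Proof. by rewrite /nrm normr0. Qed.

Lemma nrm0_eq0 x : nrm x = 0 -> x = 0.
Proof. by move=> x0; apply/normr0_eq0; rewrite -nrmC x0. Qed.

Lemma nrmN x : nrm (- x) = nrm x.
Proof. by rewrite /nrm normrN. Qed.

Lemma nrmD x y : nrm (x + y) <= nrm x + nrm y.
Proof. by rewrite -lecR rmorphD/= !nrmC ler_normD. Qed.

Lemma nrmB x y : nrm (x - y) <= nrm x + nrm y.
Proof. by rewrite -(nrmN y) nrmD. Qed.

Lemma nrmZ c x : nrm (c *: x) = complex.Re `|c| * nrm x.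
Proof.
by apply: complexI; rewrite rmorphM/= nrmC normrZ RRe_real // nrmC.
Qed.

Lemma nrm_unitZ c x : `|c| = 1 -> nrm (c *: x) = nrm x.
Proof. by move=> c1; rewrite nrmZ c1 mul1r. Qed.

Lemma nrmZr (a : R) x : nrm (a%:C *: x) = `|a| * nrm x.
Proof. by rewrite nrmZ normc_def/= expr0n addr0 sqrtr_sqr. Qed.

Lemma nrm_small x (C : R) : (forall e, 0 < e -> nrm x <= C * e) -> x = 0.
Proof.
move=> h; apply/nrm0_eq0/eqP; rewrite eq_le nrm_ge0 andbT leNgt.
apply/negP => x0; have C0 : 0 < `|C| + 1 by rewrite ltr_wpDl.
have := h _ (divr_gt0 x0 (mulr_gt0 (ltr0n _ 2) C0)).
apply/negP; rewrite -ltNge mulrCA gtr_pMr// invfM mulrCA.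
rewrite mulrC ltr_pdivrMr// mul1r ltr_pdivrMr//.
by have := ler_norm C; have := normr_ge0 C; lra.
Qed.

End Norm.

Section Linear.
Context {K : pzRingType} {U V : lmodType K} {f : U -> V}.
Hypothesis flin : linear f.

Lemma linear_add x y : f (x + y) = f x + f y.
Proof. by have := flin 1 x y; rewrite !scale1r. Qed.

Lemma linear_sub x y : f (x - y) = f x - f y.
Proof. by rewrite addrC -scaleN1r flin scaleN1r addrC. Qed.

Lemma linear_zero : f 0 = 0.
Proof. by rewrite -(subrr 0) linear_sub subrr. Qed.

Lemma linear_scale a x : f (a *: x) = a *: f x.
Proof. by rewrite -[a *: x]addr0 flin linear_zero addr0. Qed.

End Linear.

Section BoundedLinear.
Context {R : realType} {X : normedModType R[i]}.
Implicit Types (f g : X -> X).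

Lemma bounded_linear_gt0 f : bounded_linear f ->
  exists2 M : R, 0 < M & forall x, nrm (f x) <= M * nrm x.
Proof.
move=> [_ [M fM]]; exists (`|M| + 1) => [|x]; first by rewrite ltr_wpDl.
rewrite (le_trans (fM x))// ler_wpM2r ?nrm_ge0//.
by rewrite (le_trans (ler_norm M))// lerDl.
Qed.

Lemma bounded_linear_comp f g :
  bounded_linear f -> bounded_linear g -> bounded_linear (fun x => f (g x)).
Proof.
move=> bf bg; have [Mf Mf0 fM] := bounded_linear_gt0 bf.
case: bf bg => fl _ [gl [Mg gM]]; split=> [a u v|]; first by rewrite gl fl.
by exists (Mf * Mg) => x; rewrite (le_trans (fM _))// -mulrA ler_pM2l.
Qed.

Lemma bounded_linear_scaleDr f g (a : R[i]) : bounded_linear f ->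
  bounded_linear g -> bounded_linear (fun x => f x + a *: g x).
Proof.
move=> [fl [Mf fM]] [gl [Mg gM]]; split=> [b u v|].
  by rewrite fl gl !scalerDr !scalerA (mulrC a b) addrACA.
exists (Mf + complex.Re `|a| * Mg) => x; rewrite (le_trans (nrmD _ _))//.
rewrite mulrDl lerD// nrmZ -mulrA ler_wpM2l//.
by rewrite -ler0c RRe_real.
Qed.

Lemma bounded_linear_id : bounded_linear (@id X).
Proof. by split=> //; exists 1 => x; rewrite mul1r. Qed.

Lemma bounded_linear_zero : bounded_linear (fun _ : X => 0 : X).
Proof.
by split=> [a u v|]; [rewrite scaler0 addr0|exists 0 => x; rewrite mul0r nrm0].
Qed.

End BoundedLinear.

(** * Completeness: geometric approximation and uniform boundedness *)

Section Complete.
Context {R : realType} {X : completeNormedModType R[i]}.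

(** The closed balls of centre [u n] and radius [r n] are nested with vanishing radii; the limit
    lies in all of them. *)
Lemma cvg_geometric_steps (u : nat -> X) (r : nat -> R) :
    (forall n, nrm (u n.+1 - u n) <= r n / 2) ->
    (forall n, r n.+1 <= r n / 2) ->
  exists l, forall n, nrm (l - u n) <= r n.
Proof.
move=> ur rr.
have r0 n : 0 <= r n.
  by have := le_trans (nrm_ge0 _) (ur n); rewrite pmulr_lge0.
(* Each step is at most [r m / 2], hence at most [r m - r m.+1], so the steps telescope. *)
have uk n k : nrm (u (n + k)%N - u n) <= r n - r (n + k)%N.
  elim: k => [|k ih]; first by rewrite addn0 !subrr nrm0.
  rewrite addnS; set m := (n + k)%N in ih *.
  have -> : u m.+1 - u n = (u m.+1 - u m) + (u m - u n) by rewrite addrA subrK.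
  by have := nrmD (u m.+1 - u m) (u m - u n); have := ur m; have := rr m; lra.
have rg n : r n <= r 0 * 2^-1 ^+ n.
  elim: n => [|n ih]; first by rewrite expr0 mulr1.
  by rewrite exprS; have := rr n; lra.
have rcvg (e : R) : 0 < e -> exists N, forall n, (N <= n)%N -> r n < e.
  move=> e0; have : (fun n => r 0 * 2^-1 ^+ n) @ \oo --> (0 : R).
    apply: cvg_geometric; rewrite ger0_norm ?invr_ge0// invf_lt1// ltr1n//.
  move=> /cvgrPdist_lt /(_ _ e0)[N _ hN]; exists N => n /hN.
  rewrite sub0r normrN ger0_norm; last by rewrite (le_trans (r0 n)).
  exact: le_lt_trans.
have : cvg (u @ \oo).
  apply/cauchy_cvgP/cauchy_ballP => e e0.
  have ee : (complex.Re e)%:C = e by rewrite RRe_real ?gtr0_real. 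
  have e'0 : 0 < complex.Re e by rewrite -ltcR ee.
  have [N hN] := rcvg _ (divr_gt0 e'0 (ltr0n _ 2)).
  have close n : (N <= n)%N -> nrm (u n - u N) < complex.Re e / 2.
    move=> Nn; rewrite -(subnKC Nn) (le_lt_trans (uk _ _))//.
    by rewrite (le_lt_trans _ (hN _ (leqnn N)))// lerBlDr lerDl.
  exists ([set x | nrm (x - u N) < complex.Re e / 2],
          [set x | nrm (x - u N) < complex.Re e / 2]) => /=.
    by split; exists N => // n /= /close.
  move=> [x y] /= [xN yN].
  rewrite -ball_normE/= -ee -nrmC ltcR.
  have -> : x - y = (x - u N) - (y - u N) by rewrite opprB addrA subrK.
  by rewrite (le_lt_trans (nrmB _ _))// [ltRHS]splitr ltrD.
move=> /cvg_ex[l ul]; exists l => n.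
apply/ler_addgt0Pr => e e0.
have e0C : (0 : R[i]) < e%:C by rewrite ltcR.
have [N _ hN] : \forall k \near \oo, `|l - u k| < e%:C.
  by move/cvgrPdist_lt: ul; apply.
have := hN (n + N)%N (leq_addl _ _); rewrite /= -nrmC ltcR => lu.
have -> : l - u n = (l - u (n + N)%N) + (u (n + N)%N - u n).
  by rewrite addrA subrK.
by have := nrmD (l - u (n + N)%N) (u (n + N)%N - u n);
  have := uk n N; have := r0 (n + N)%N; lra.
Qed.

(* Banach-Steinhaus by gliding hump. *)
Lemma condensation (P : nat -> (X -> X) -> Prop) :
    (forall n f, P n f -> bounded_linear f) ->
    (forall n (M : R), exists f, P n f /\ exists x, M * nrm x < nrm (f x)) ->
  exists x, forall n, exists2 f, P n f & n%:R < nrm (f x).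
Proof.
move=> Pb Pu.
(* A state is a closed ball, stored as centre and radius. A good successor is a sub-ball of at most
   half the radius on which one operator of [P n] exceeds [n]. *)
pose good n (s s' : X * R) := [/\ 0 < s'.2, s'.2 <= s.2 / 2,
  nrm (s'.1 - s.1) <= s.2 / 2 &
  exists2 f, P n f & forall y, nrm (y - s'.1) <= s'.2 -> n%:R < nrm (f y)].
have step n (s : X * R) : exists s', 0 < s.2 -> good n s s'.
  have [r0|r0] := ltP 0 s.2; last by exists s.
  set x := s.1; set r := s.2 in r0.
  (* The factor ensures that [v], rescaled to length [r / 2], has an image longer than [n + 1]. *)
  have [f [Pf [v fv]]] := Pu n ((n%:R + 1) * 2 / r).
  have [flin _] := Pb _ _ Pf.
  have [M M0 fM] := bounded_linear_gt0 (Pb _ _ Pf).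
  have v0 : 0 < nrm v.
    rewrite lt0r nrm_ge0 andbT; apply/eqP => v0; move: fv.
    by rewrite (nrm0_eq0 v0) (linear_zero flin) nrm0 mulr0 ltxx.
  pose xi := (r / 2 / nrm v)%:C *: v.
  have xir : nrm xi = r / 2.
    by rewrite nrmZr ger0_norm ?divr_ge0 ?nrm_ge0 ?ltW// divfK ?gt_eqF.
  have fxi : n%:R + 1 < nrm (f xi).
    rewrite linear_scale// nrmZr ger0_norm ?divr_ge0 ?nrm_ge0 ?ltW//.
    rewrite mulrC mulrA ltr_pdivlMr//.
    move: fv; rewrite -[(n%:R + 1) * 2 / r * nrm v]mulrAC ltr_pdivrMr//.
    by lra.
  (* Since [2 f(xi) = f(x + xi) - f(x - xi)], one of [x + xi] and [x - xi] has a long enough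
     image. *)
  have [x' xx' fx'] : exists2 x', nrm (x' - x) <= r / 2 & n%:R + 1 < nrm (f x').
    have [h|h] := ltP (n%:R + 1) (nrm (f (x + xi))).
      by exists (x + xi) => //; rewrite addrAC subrr add0r xir.
    exists (x - xi); first by rewrite addrAC subrr add0r nrmN xir.
    have : nrm (f xi + f xi) <= nrm (f (x + xi)) + nrm (f (x - xi)).
      rewrite (linear_add flin) (linear_sub flin).
      rewrite (_ : f xi + f xi = (f x + f xi) - (f x - f xi)) ?nrmB//.
      by rewrite opprB [f x + f xi]addrC addrACA subrr addr0.
    have -> : f xi + f xi = (2 : R)%:C *: f xi.
      by rewrite -mulr2n -scaler_nat -(rmorph_nat (real_complex R)).
    by rewrite nrmZr ger0_norm//; lra.
  (* Within radius [M^-1] the image moves by at most 1, so its norm stays above [n]. *)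
  exists (x', Num.min (r / 2) M^-1); split => /=.
  - by rewrite lt_min divr_gt0// invr_gt0.
  - by rewrite ge_min lexx.
  - by [].
  exists f => // y /=; rewrite le_min => /andP[_ yx].
  have : nrm (f (y - x')) <= 1.
    by rewrite (le_trans (fM _))// mulrC -ler_pdivlMr// div1r.
  have : nrm (f x') <= nrm (f y) + nrm (f (y - x')).
    rewrite (linear_sub flin) [in leLHS](_ : f x' = f y - (f y - f x')) ?nrmB//.
    by rewrite opprB addrC subrK.
  by lra.
have [F hF] := choice (fun p : nat * (X * R) => step p.1 p.2).
pose s := fix s n := if n is k.+1 then F (k, s k) else ((0 : X), (1 : R)).
have s0 n : 0 < (s n).2.
  by elim: n => [|n ih] /=; [exact: ltr01|have [] := hF (n, s n) ih].
have gs n : good n (s n) (s n.+1) by exact: (hF (n, s n) (s0 n)).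
have [|n|x xs] := @cvg_geometric_steps (fun n => (s n).1) (fun n => (s n).2).
- by move=> n; have [] := gs n.
- by have [] := gs n.
by exists x => n; have [_ _ _ [f Pf hf]] := gs n; exists f => //; exact: hf.
Qed.

End Complete.

(** * The unit circle parametrized by the angle *)

Section Cis.
Context {R : realType}.
Implicit Types a b : R.

Definition cis a : R[i] := cos a +i* sin a.

Lemma norm_cis a : `|cis a| = 1.
Proof. by rewrite normc_def/= cos2Dsin2 sqrtr1. Qed.

Lemma cis0 : cis 0 = 1.
Proof. by rewrite /cis cos0 sin0. Qed.

Lemma cis_addpi a : cis (a + pi) = - cis a.
Proof. by rewrite /cis cosDpi sinDpi. Qed.

Lemma cis_sqr a : cis a ^+ 2 = cis (a + a).
Proof.
rewrite /cis expr2 cosD sinD; apply/eqP; rewrite eq_complex/=.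
by rewrite eqxx [cos a * _]mulrC eqxx.
Qed.

Lemma cis_dist a b :
  complex.Re `|cis a - cis b| <= `|cos a - cos b| + `|sin a - sin b|.
Proof.
rewrite normc_def/= -ler_sqr ?nnegrE ?addr_ge0 ?sqrtr_ge0//.
rewrite sqr_sqrtr ?addr_ge0 ?sqr_ge0// [leRHS]sqrrD !real_normK ?num_real//.
by rewrite lerD2r lerDl mulrn_wge0// mulr_ge0.
Qed.

End Cis.

(** * From an operator to its square *)

Section SpectralDoubling.
Context {R : realType} {X : normedModType R[i]}.
Implicit Types (w S : X -> X) (l : R[i]).

Definition resolvent_op w l S :=
  [/\ bounded_linear S, forall x, S (w x - l *: x) = x &
      forall x, w (S x) - l *: S x = x].

(* For [|l| = 1] this bounds [l w (w - l)^-2], i.e. [z / (1 - z)^2] at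
   [z = w / l], which is small when [z] is near [0] or infinity. *)
Definition small_at w l (e : R) :=
  exists2 S, resolvent_op w l S & forall x, nrm (w (S (S x))) <= e * nrm x.

Lemma shift_comm w l x : linear w ->
  w (w x + l *: x) - l *: (w x + l *: x) = w (w x) - l ^+ 2 *: x.
Proof.
move=> wl; rewrite (linear_add wl) (linear_scale wl) scalerDr scalerA opprD.
by rewrite addrA addrK expr2.
Qed.

(* With [z = l^-1 w], this is the partial fraction identity
   [z / (1 - z)^2 + (- z) / (1 + z)^2 = 4 z^2 / (1 - z^2)^2]. *)
Lemma small_at_double w l e : linear w -> `|l| = 1 ->
  small_at w l e -> small_at w (- l) e ->
  small_at (fun x => w (w x)) (l ^+ 2) (e / 2).
Proof.
move=> wl l1 [S [Sb SK KS] Se] [U [Ub UK KU] Ue].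
pose A x := w x - l *: x; pose B x := w x + l *: x.
have AS x : A (S x) = x by exact: KS.
have SA x : S (A x) = x by exact: SK.
have BU x : B (U x) = x by rewrite -[RHS]KU scaleNr opprK.
have UB x : U (B x) = x by rewrite -[RHS]UK scaleNr opprK.
have AB x : A (B x) = w (w x) - l ^+ 2 *: x by exact: shift_comm.
have BA x : B (A x) = w (w x) - l ^+ 2 *: x.
  have := shift_comm (- l) x wl; rewrite sqrrN => <-.
  by rewrite !scaleNr opprK.
exists (fun x => U (S x)); first split => [|x|x].
- exact: bounded_linear_comp.
- by rewrite -AB SA UB.
- by rewrite -AB BU AS.
(* [y] is the new resolvent [U \o S] applied twice to [x]. In terms of [y], [S (S x)] and [U (U x)]
   become [B (B y)] and [A (A y)], whose difference is [4 l w y]. *)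
move=> x; set y := U (S (U (S x))).
have xE : x = A (B (A (B y))) by rewrite BU AS BU AS.
have SSx : S (S x) = B (B y).
  by rewrite xE SA BA -AB SA.
have UUx : U (U x) = A (A y).
  by rewrite xE [A (B (A _))]AB -BA UB AB -BA AB -BA UB.
have diff : S (S x) - U (U x) = (4%:R * l) *: w y.
  have BE z : B z = A z + (2%:R * l) *: z.
    rewrite /A /B -addrA; congr (_ + _).
    by rewrite -scaleNr -scalerDl; congr (_ *: _); ring.
  rewrite SSx UUx BE AB -BA BE addrAC [_ + _ - _]addrAC subrr add0r.
  rewrite -scalerDr /A /B addrCA subrK -mulr2n -[w y *+ 2]scaler_nat scalerA.
  by congr (_ *: _); ring.
have : nrm (w (S (S x)) - w (U (U x))) <= e * nrm x + e * nrm x.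
  by rewrite (le_trans (nrmB _ _))// lerD.
rewrite -(linear_sub wl) diff (linear_scale wl) -scalerA nrmZ.
rewrite nrm_unitZ// normr_nat.
have -> : complex.Re (4%:R : R[i]) = 4%:R.
  by rewrite -(rmorph_nat (real_complex R)).
by lra.
Qed.

End SpectralDoubling.

(** * Uniform resolvent bounds on the circle and repeated squaring *)

Section Hyperbolic.
Context {R : realType} {X : normedModType R[i]}.

(* Openness of the resolvent set is not needed: the resolvents exist on the
   whole circle, and a lower bound for [f - l0] propagates to nearby [l]. *)
Lemma resolvent_uniform_bound (f : X -> X) (a b : R) :
    (forall t, exists S, resolvent_op f (cis t) S) ->
  exists M, forall t, a <= t <= b -> exists2 S, resolvent_op f (cis t) S &
    forall x, nrm (S x) <= M * nrm x.
Proof.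
move=> fS.
(* Compactness turns local bounds, valid for all large [M], into one bound for all angles of the
   segment. *)
have := (compact_near_coveringP _).1 (@segment_compact R a b).
move=> /(_ R (pinfty_nbhs R) (fun M t => exists2 S, resolvent_op f (cis t) S &
    forall x, nrm (S x) <= M * nrm x) _).
case=> [t _|M0 [_ hM]]; last first.
  exists (M0 + 1) => t tab; apply: (hM (M0 + 1) _ t); first by rewrite ltrDl.
  by rewrite /= in_itv.
have [S0 [S0b S0K _]] := fS t.
have [M M0 SM] := bounded_linear_gt0 S0b.
(* Cosine and sine each vary by less than [1 / (4 M)], so the perturbation costs at most half of
   [nrm y]; absorbing it doubles [M], hence the threshold [2 * M] below. *)
have e0 : 0 < (M * 4)^-1 by rewrite invr_gt0 mulr_gt0.
have ct : \forall t' \near t, `|cos t' - cos t| < (M * 4)^-1.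
  have /cvgrPdist_lt /(_ _ e0) := @continuous_cos R t.
  by apply: filterS => t'; rewrite distrC.
have st : \forall t' \near t, `|sin t' - sin t| < (M * 4)^-1.
  have /cvgrPdist_lt /(_ _ e0) := @continuous_sin R t.
  by apply: filterS => t'; rewrite distrC.
exists ([set t' | `|cos t' - cos t| < (M * 4)^-1 /\
                  `|sin t' - sin t| < (M * 4)^-1], [set M' | 2 * M < M']).
  by split => /=; [exact: filterI|exists (2 * M); split; rewrite ?num_real].
move=> [t' M'] /= [[ct' st'] MM'].
have [S [Sb SK KS]] := fS t'; exists S => // x.
set y := S x; have -> : x = f y - cis t' *: y by rewrite KS.
have : nrm y <= M * nrm (f y - cis t *: y).
  by rewrite -[y in nrm y]S0K; exact: SM.
have -> : f y - cis t *: y = (f y - cis t' *: y) + (cis t' - cis t) *: y.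
  by rewrite scalerBl addrA subrK.
have := nrmD (f y - cis t' *: y) ((cis t' - cis t) *: y).
rewrite nrmZ; have := cis_dist t' t; have := nrm_ge0 y.
have := nrm_ge0 (f y - cis t' *: y).
move: (nrm (_ + _)) (nrm y) (nrm _) (complex.Re _) => p q r s r0 q0 s1 pr qp.
have s2 : s * M <= 2^-1.
  have : (M * 4)^-1 * M = 4^-1 by rewrite invfM mulrAC mulVf ?gt_eqF// mul1r.
  have : s * M <= ((M * 4)^-1 + (M * 4)^-1) * M.
    by rewrite ler_pM2r// (le_trans s1)// ltW// ltrD.
  by lra.
have : q <= M * r + 2^-1 * q.
  rewrite (le_trans qp)// (le_trans (ler_wpM2l (ltW M0) pr))// mulrDr lerD2l.
  by rewrite mulrA (mulrC M) ler_wpM2r.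
have : (2 * M) * r <= M' * r by rewrite ler_wpM2r// ltW.
by lra.
Qed.

(** The square roots of [cis t] are [cis (t / 2)] and [cis (t / 2 + pi)]. For [t] in [[0, 2 pi]]
    both angles stay in this interval, so [small_at_double] can be iterated. *)
Lemma small_at_dyadic (T : nat -> X -> X) (e : R) n :
    (forall n, linear (T n)) -> (forall n x, T n.+1 x = T n (T n x)) ->
    (forall t, 0 <= t <= pi + pi -> small_at (T 0%N) (cis t) e) ->
  forall t, 0 <= t <= pi + pi -> small_at (T n) (cis t) (e / 2 ^+ n).
Proof.
move=> Tl Td T0; elim: n => [|n ih] t /andP[t0 t1].
  by rewrite expr0 divr1; apply: T0; rewrite t0 t1.
have pi0 := pi_ge0 R.
have -> : T n.+1 = (fun x => T n (T n x)) by apply/funext => x; exact: Td.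
rewrite exprSr invfM mulrA [t]splitr -cis_sqr.
apply: small_at_double; rewrite ?norm_cis//.
  by apply: ih; lra.
by rewrite -cis_addpi; apply: ih; lra.
Qed.

End Hyperbolic.

(** * Bounded, vanishing solutions of the discrete recurrence *)

Section DiscreteShadowing.
Context {R : realType} {X : completeNormedModType R[i]}.
Implicit Types (F G E : nat -> X).

Lemma cvg0_le (u v : nat -> R) : (forall n, 0 <= u n <= v n) ->
  v @ \oo --> (0 : R) -> u @ \oo --> (0 : R).
Proof.
move=> uv v0; apply: (squeeze_cvgr _ (cvg_cst 0) v0).
by near=> n; exact: uv.
Unshelve. all: by end_near. Qed.

Definition shiftr F n : X := if n is k.+1 then F k else 0.

Definition second_diff F n : X := F n.+1 + shiftr F n - F n - F n.

Lemma nrm_shiftr F (c : R) n :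
  (forall n, nrm (F n) <= c) -> nrm (shiftr F n) <= c.
Proof.
move=> Fc; case: n => [|n] /=; last exact: Fc.
by rewrite nrm0 (le_trans (nrm_ge0 (F 0%N))).
Qed.

Lemma nrm_second_diff F n : nrm (second_diff F n) <=
  nrm (F n.+1) + nrm (shiftr F n) + nrm (F n) + nrm (F n).
Proof. by do 2 rewrite (le_trans (nrmB _ _)) ?lerD2r//; exact: nrmD. Qed.

Lemma second_diffB F G n : second_diff (fun n => F n - G n) n =
  second_diff F n - second_diff G n.
Proof.
have -> : second_diff (fun n => F n - G n) n =
    (F n.+1 - G n.+1) + (shiftr F n - shiftr G n) - (F n - G n) - (F n - G n).
  by case: n => [|n]; rewrite /second_diff//= subrr.
rewrite /second_diff !opprD !opprK !addrA.
by rewrite [LHS](ACl (1*3*5*7*2*4*6*8)).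
Qed.

Lemma cvg_shiftr F : (fun n => nrm (F n)) @ \oo --> (0 : R) ->
  (fun n => nrm (shiftr F n)) @ \oo --> (0 : R).
Proof. by rewrite -(cvg_shiftS (fun n => nrm (shiftr F n))). Qed.

Lemma cvg_second_diff F : (fun n => nrm (F n)) @ \oo --> (0 : R) ->
  (fun n => nrm (second_diff F n)) @ \oo --> (0 : R).
Proof.
move=> F0; apply: cvg0_le.
  by move=> n; rewrite nrm_ge0; exact: nrm_second_diff.
rewrite -[X in _ --> X]addr0 -[X in _ --> X + _]addr0.
rewrite -[X in _ --> X + _ + _]addr0.
apply: cvgD => //; apply: cvgD => //; apply: cvgD; last exact: cvg_shiftr.
by rewrite (cvg_shiftS (fun n => nrm (F n))).
Qed.

Section Neumann.
Context (Y : X -> X).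
Hypotheses (Yl : linear Y) (Y8 : forall x, nrm (Y x) <= 8^-1 * nrm x).

(** A second difference has four terms, so the factor [8^-1] leaves a contraction of ratio 1/2. *)
Lemma nrm_second_diff_op F (c : R) n : (forall n, nrm (F n) <= c) ->
  nrm (Y (second_diff F n)) <= c / 2.
Proof.
move=> Fc; have := Y8 (second_diff F n); have := nrm_second_diff F n.
by have := nrm_shiftr n Fc; have := Fc n; have := Fc n.+1; lra.
Qed.

(** Picard iteration from 0 for a contraction of ratio 1/2 in the sup norm. Limits are taken index
    by index, but the error [r k] does not depend on [n], which transfers decay from the iterates to
    [F]. *)
Lemma neumann_second_diff E (B : R) : (forall n, nrm (E n) <= B) ->
  (fun n => nrm (E n)) @ \oo --> (0 : R) ->
  exists F, [/\ forall n, nrm (F n) <= 2 * B,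
    (fun n => nrm (F n)) @ \oo --> (0 : R) &
    forall n, F n = E n + Y (second_diff F n)].
Proof.
move=> EB E0.
pose s := fix s k n := if k is k'.+1 then E n + Y (second_diff (s k') n) else 0.
pose r k : R := 2 * B * 2^-1 ^+ k.
have rS k : r k.+1 = r k / 2 by rewrite /r exprSr mulrA.
have sr k n : nrm (s k.+1 n - s k n) <= r k / 2.
  elim: k n => [|k ih] n.
    rewrite /= subr0 -[second_diff _ _]/(second_diff (fun=> 0) n) /second_diff.
    have -> : shiftr (fun=> 0) n = 0 by case: n.
    by rewrite !subr0 addr0 (linear_zero Yl) addr0 /r expr0; have := EB n; lra.
  have -> : s k.+2 n - s k.+1 n =
      Y (second_diff (fun n => s k.+1 n - s k n) n).
    by rewrite second_diffB (linear_sub Yl) /= opprD addrACA subrr add0r.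
  by rewrite rS; exact: nrm_second_diff_op.
have /choice[F Fs] n : exists l, forall k, nrm (l - s k n) <= r k.
  by apply: cvg_geometric_steps => k; [exact: sr|rewrite rS].
have rsmall (e : R) : 0 < e -> exists k, r k < e.
  move=> e0; have : r @ \oo --> (0 : R).
    by apply: cvg_geometric; rewrite ger0_norm ?invr_ge0// invf_lt1// ltr1n.
  move=> /cvgrPdist_lt /(_ _ e0)[k _ /(_ k (leqnn k))] /=.
  by rewrite sub0r normrN => rk; exists k; exact: le_lt_trans (ler_norm _) rk.
exists F; split=> [n||n].
- by have := Fs n 0%N; rewrite subr0 /r expr0 mulr1.
- have s0 k : (fun n => nrm (s k n)) @ \oo --> (0 : R).
    elim: k => [|k ih]; first by rewrite /= nrm0; exact: cvg_cst.
    have h n : 0 <= nrm (s k.+1 n) <= nrm (E n) + nrm (second_diff (s k) n).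
      rewrite nrm_ge0 (le_trans (nrmD _ _))// lerD2l (le_trans (Y8 _))//.
      by have := nrm_ge0 (second_diff (s k) n); lra.
    apply: cvg0_le h _; rewrite -[X in _ --> X]addr0.
    by apply: cvgD => //; exact: cvg_second_diff.
  apply/cvgrPdist_lt => e e0; have [k rk] := rsmall _ (divr_gt0 e0 (ltr0n _ 2)).
  have /cvgrPdist_lt /(_ _ (divr_gt0 e0 (ltr0n _ 2))) := s0 k.
  apply: filterS => n; rewrite !sub0r !normrN !ger0_norm ?nrm_ge0//.
  have := nrmD (F n - s k n) (s k n); rewrite subrK.
  by have := Fs n k; lra.
apply/eqP; rewrite -subr_eq0; apply/eqP; apply: (@nrm_small _ _ _ 1) => e e0.
have [k rk] := rsmall _ e0.
have -> : F n - (E n + Y (second_diff F n)) =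
    (F n - s k.+1 n) - Y (second_diff (fun n => F n - s k n) n).
  rewrite second_diffB (linear_sub Yl (second_diff F n)) /=.
  move: (Y (second_diff F n)) (Y _) => a b.
  by rewrite !opprD !opprK !addrA [RHS](ACl (1*2*4*5*3)) /= addrK.
have := nrm_second_diff_op n (fun n => Fs n k); have := Fs n k.+1.
have := nrmB (F n - s k.+1 n) (Y (second_diff (fun n => F n - s k n) n)).
by rewrite rS; lra.
Qed.

End Neumann.

(* [S \o S] and [w \o S \o S] approximate the projection on the contracted part
   and minus the inverse of [w] on the expanded part; the defect of the
   resulting approximate solution is [w \o S \o S] of a second difference. *)
Lemma bounded_solution (w S : X -> X) : linear w -> resolvent_op w 1 S ->
    (forall x, nrm (w (S (S x))) <= 8^-1 * nrm x) ->
  exists2 K : R, 0 < K & forall E (B : R), (forall n, nrm (E n) <= B) ->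
    (fun n => nrm (E n)) @ \oo --> (0 : R) ->
  exists z, [/\ forall n, nrm (z n) <= K * B,
    (fun n => nrm (z n)) @ \oo --> (0 : R) &
    forall n, z n.+1 = w (z n) + E n].
Proof.
move=> wl [Sb _ KS] Y8.
pose Y x := w (S (S x)).
have Sl : linear S by case: Sb.
have Yl : linear Y by move=> a u v; rewrite /Y Sl Sl wl.
(* With [V = S \o S] and [Y = w \o V], this is [w^2 V = 1 + 2 w V - V], a rewriting of
   [(w - 1)^2 V = 1]. *)
have wYE x : w (Y x) = x + Y x + Y x - S (S x).
  have E1 : Y x = S x + S (S x) by rewrite -[X in X + _]KS scale1r subrK.
  have E2 : w (S x) = x + S x by rewrite -[X in X + _]KS scale1r subrK.
  rewrite {1}E1 (linear_add wl) E2 -/(Y x).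
  by rewrite [X in x + X + _ - _]E1 !addrA [RHS]addrAC addrK.
have [M M0 VM] := bounded_linear_gt0 (bounded_linear_comp Sb Sb).
(* [F] is bounded by [2 * B], while [S \o S] and [Y] are bounded by [M] and 1/8. *)
exists (2 * (M + 1)) => [|E B EB E0]; first by rewrite mulr_gt0// addr_gt0.
have [F [FB F0 FE]] := neumann_second_diff Yl Y8 EB E0.
exists (fun n => S (S (shiftr F n)) - Y (F n)); split => [n||n].
- have := VM (shiftr F n); have := Y8 (F n).
  have := nrmB (S (S (shiftr F n))) (Y (F n)).
  have := FB n; have := nrm_ge0 (F n); have := nrm_shiftr n FB.
  rewrite -/(Y (F n)).
  move=> h1 h2 h3 h4 h5 h6; rewrite (le_trans h4)// mulrAC mulrDr mulr1.
  apply: lerD; last by lra.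
  by rewrite (le_trans h6)// mulrC ler_pM2r.
- have h n : 0 <= nrm (S (S (shiftr F n)) - Y (F n)) <=
      M * nrm (shiftr F n) + 8^-1 * nrm (F n).
    by rewrite nrm_ge0 (le_trans (nrmB _ _))// lerD// ?VM ?Y8.
  apply: cvg0_le h _; rewrite -[X in _ --> X]addr0.
  rewrite -[X in _ --> X + _](mulr0 M) -[X in _ --> _ + X](mulr0 8^-1).
  by apply: cvgD; apply: cvgMl_tmp => //; exact: cvg_shiftr.
rewrite /= (linear_sub wl) wYE -/(Y _).
have -> : E n = F n - Y (second_diff F n) by rewrite {1}FE addrK.
rewrite /second_diff !(linear_sub Yl, linear_add Yl).
rewrite !opprD !opprK !addrA [RHS](ACl (5*7*1*8*2*6*3*9*4*10)).
by rewrite /= addrK !subrK addrK.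
Qed.

End DiscreteShadowing.

(** * Uniform bounds on compact time intervals *)

Section LocalBound.
Context {R : realType} {X : completeNormedModType R[i]}.
Context {T : R -> X -> X}.
Hypothesis hT : C0_semigroup T.

Lemma semigroup0 x : T 0 x = x.
Proof. by case: hT => -[[_ h _] _] _. Qed.

Lemma semigroupD s t x : 0 <= s -> 0 <= t -> T (s + t) x = T s (T t x).
Proof. by case: hT => -[[_ _ h] _] _; exact: h. Qed.

Lemma semigroup_bounded_linear t : 0 <= t -> bounded_linear (T t).
Proof. by case: hT => -[_ h] _; exact: h. Qed.

Lemma semigroup_linear t : 0 <= t -> linear (T t).
Proof. by move=> /semigroup_bounded_linear[]. Qed.

(** Otherwise [condensation] yields one [x] and, for every [n], a time [t < 1 / (n + 1)] with
    [nrm (T t x) > n], against [T t x] tending to [x]. *)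
Lemma semigroup_bound_right0 : exists2 d : R, 0 < d & exists C : R,
  forall t x, 0 < t < d -> nrm (T t x) <= C * nrm x.
Proof.
apply: contrapT => h.
have [|n M|x xP] := @condensation R X
    (fun n f => exists2 t, 0 < t < n.+1%:R^-1 & f = T t).
- move=> n f [t /andP[t0 _] ->].
  by apply: semigroup_bounded_linear; exact: ltW.
- apply: contrapT => h1; apply: h; exists n.+1%:R^-1; first by rewrite invr_gt0.
  exists M => t x td; rewrite leNgt; apply/negP => Mt; apply: h1.
  by exists (T t); split; [exists t|exists x].
have [_ /(_ x)] := hT.
move=> /cvgrPdist_lt /(_ _ ltr01) /nbhs_ballP[d /= d0 hd].
(* Such an [n] both exceeds [nrm x + 1] and forces [1 / (n + 1) < d]. *)
have [n nP] : exists n : nat, nrm x + 1 + d^-1 < n%:R.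
  by exists (Num.bound (nrm x + 1 + d^-1)); apply: archi_boundP;
    rewrite addr_ge0 ?addr_ge0 ?nrm_ge0 ?invr_ge0// ltW.
have [_ [t /andP[t0 tn] ->] ntx] := xP n.
have d'0 : 0 < d^-1 by rewrite invr_gt0.
have td : t < d.
  rewrite (lt_trans tn)// invf_plt ?posrE// -natr1.
  by have := nrm_ge0 x; lra.
have /hd/(_ t0) : ball (0 : R) d t by rewrite /ball/= sub0r normrN gtr0_norm.
rewrite sub0r normrN ger0_norm ?nrm_ge0// /ndist => tx1.
by have := nrmD (T t x - x) x; rewrite subrK; lra.
Qed.

(** Cut the interval into steps of length [d / 2] and multiply the local bounds; [C] is at least 1
    so that time 0 and shorter products are covered. *)
Lemma semigroup_bound (b : R) : exists2 C : R, 0 < C &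
  forall t x, 0 <= t <= b -> nrm (T t x) <= C * nrm x.
Proof.
have [d d0 [C0 hC0]] := semigroup_bound_right0.
pose C := Num.max C0 1.
have C1 : 1 <= C by rewrite le_max lexx orbT.
have Cpos : 0 < C by rewrite (lt_le_trans ltr01).
have hC t x : 0 <= t < d -> nrm (T t x) <= C * nrm x.
  move=> /andP[]; rewrite le_eqVlt => /predU1P[<- _|t0 td].
    by rewrite semigroup0 ler_peMl// nrm_ge0.
  by rewrite (le_trans (hC0 t x _)) ?t0// ler_wpM2r ?nrm_ge0// le_max lexx.
have d2 : 0 < d / 2 by rewrite divr_gt0.
have Cn n t x : 0 <= t <= n%:R * (d / 2) -> nrm (T t x) <= C ^+ n * nrm x.
  elim: n t => [|n ih] t /andP[t0].
    rewrite mul0r => t0'; have -> : t = 0 by apply/eqP; rewrite eq_le t0 t0'.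
    by rewrite semigroup0 expr0 mul1r.
  rewrite -natr1 mulrDl mul1r => tn.
  have [td|td] := leP t (d / 2).
    have tdd : 0 <= t < d by lra.
    by rewrite (le_trans (hC _ x tdd))// ler_wpM2r ?nrm_ge0// exprS ler_peMr
      ?exprn_ege1// ltW.
  rewrite -(subrKC (d / 2) t) semigroupD; [|by lra..].
  have dd : 0 <= d / 2 < d by lra.
  rewrite (le_trans (hC _ _ dd))//.
  by rewrite exprS -mulrA ler_pM2l// ih//; lra.
have [n nP] : exists n : nat, `|b| / (d / 2) < n%:R.
  exists (Num.bound (`|b| / (d / 2))); apply: archi_boundP.
  by rewrite divr_ge0// ltW.
exists (C ^+ n); first by rewrite exprn_gt0.
move=> t x /andP[t0 tb]; apply: Cn; rewrite t0/= (le_trans tb)//.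
by rewrite (le_trans (ler_norm b))// ltW// -ltr_pdivrMr.
Qed.

End LocalBound.

(** * Locating a time among the jump times *)

Section Index.
Context {R : realType} (t_ : nat -> R) (r : R).
Hypotheses (r0 : 0 < r) (rt : forall i, r <= t_ i).

Lemma hat_time0 : hat_time t_ 0 = 0.
Proof. by rewrite /hat_time big_geq. Qed.

Lemma hat_timeS i : hat_time t_ i.+1 = hat_time t_ i + t_ i.
Proof. by rewrite /hat_time big_nat_recr. Qed.

Lemma hat_time_le i j : (i <= j)%N -> hat_time t_ i <= hat_time t_ j.
Proof.
move=> /subnKC <-; elim: (j - i)%N => [|k ih]; first by rewrite addn0.
by rewrite addnS hat_timeS (le_trans ih)// lerDl (le_trans _ (rt _))// ltW.
Qed.

Lemma hat_time_ge i : i%:R * r <= hat_time t_ i.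
Proof.
elim: i => [|i ih]; first by rewrite hat_time0 mul0r.
by rewrite hat_timeS -natr1 mulrDl mul1r lerD.
Qed.

Definition time_index t i := hat_time t_ i <= t < hat_time t_ i.+1.

Lemma hat_time_index t i N : hat_time t_ N <= t -> time_index t i -> (N <= i)%N.
Proof.
move=> Nt /andP[_ ti]; rewrite leqNgt; apply/negP => iN.
by have := le_lt_trans (le_trans (hat_time_le iN) Nt) ti; rewrite ltxx.
Qed.

Lemma time_index_unique t i j : time_index t i -> time_index t j -> i = j.
Proof.
move=> ti tj; apply/eqP; rewrite eqn_leq.
by rewrite (hat_time_index _ tj) ?(hat_time_index _ ti)//;
  [case/andP: tj|case/andP: ti].
Qed.

Lemma time_index_ex t : 0 <= t -> exists i, time_index t i.
Proof.
move=> t0; have [n tn] : exists n, t < hat_time t_ n.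
  exists (Num.bound (t / r)); rewrite (lt_le_trans _ (hat_time_ge _))//.
  by rewrite -ltr_pdivrMr// archi_boundP// divr_ge0// ltW.
elim: n tn => [|n ih tn]; first by rewrite hat_time0 ltNge t0.
by have [tn'|nt] := ltP t (hat_time t_ n); [exact: ih|exists n; apply/andP].
Qed.

Lemma starE (X : Type) (T : R -> X -> X) x_ t i : time_index t i ->
  star T x_ t_ t = T (t - hat_time t_ i) (x_ i).
Proof.
move=> ti; rewrite /star; case: xgetP => [j _ tj|/(_ i)] //.
by rewrite (time_index_unique ti tj).
Qed.

End Index.

Lemma increasing_homeomorphism_id (R : realType) :
  increasing_homeomorphism (@id R).
Proof.
split=> //; exists id; split => //.
by split; apply: continuous_subspaceT => x; exact: cvg_id.
Qed.

(** * From hyperbolicity to L-shadowing *)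

Section Shadowing.
Context {R : realType} {X : completeNormedModType R[i]}.
Context {T : R -> X -> X}.
Hypothesis hT : C0_semigroup T.

Definition jump (x_ : nat -> X) (t_ : nat -> R) i :=
  ndist (T (t_ i) (x_ i)) (x_ i.+1).

(** All gaps are at least [r], so at most one jump is crossed between [s] and [t]. With none the two
    points agree; with one, their difference is that jump carried along for time at most [r]. *)
Lemma star_step (r C : R) (x_ : nat -> X) (t_ : nat -> R) (s t : R) (i : nat) :
    0 < r -> (forall i, r <= t_ i) ->
    (forall u x, 0 <= u <= r -> nrm (T u x) <= C * nrm x) ->
    time_index t_ s i -> s <= t <= s + r ->
  nrm (T (t - s) (star T x_ t_ s) - star T x_ t_ t) <= C * jump x_ t_ i.
Proof.
move=> r0 rt TC si /andP[st tr].
have C0 (x : X) : 0 <= C * nrm x.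
  have rr : (0 : R) <= 0 <= r by lra.
  by rewrite (le_trans _ (TC 0 x rr))// nrm_ge0.
rewrite (starE r0 rt _ _ si); have /andP[is1 si1] := si.
have [ti|ti] := ltP t (hat_time t_ i.+1).
  have ti' : time_index t_ t i by rewrite /time_index ti (le_trans is1).
  rewrite (starE r0 rt _ _ ti') -semigroupD//; [|by lra..].
  by rewrite addrA subrK subrr nrm0; exact: C0.
have ti' : time_index t_ t i.+1.
  rewrite /time_index ti hat_timeS (le_lt_trans tr)//.
  by have := rt i.+1; lra.
rewrite (starE r0 rt _ _ ti') -semigroupD//; [|by lra..].
have -> : t - s + (s - hat_time t_ i) = (t - hat_time t_ i.+1) + t_ i.
  by rewrite hat_timeS; ring.
have ti0 : 0 <= t - hat_time t_ i.+1 by rewrite subr_ge0.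
rewrite semigroupD//; last by rewrite (le_trans _ (rt i))// ltW.
rewrite -(linear_sub (semigroup_linear hT ti0)); apply: TC.
by rewrite ti0/=; lra.
Qed.

Lemma near_infty_eventually (f : R -> R) : (forall t, 0 <= t -> 0 <= f t) ->
    (forall e, 0 < e -> exists M, forall t, 0 <= t -> M <= t -> f t < e) ->
  f t @[t --> +oo] --> (0 : R).
Proof.
move=> f0 h; apply/cvgrPdist_lt => e /h[M hM].
exists (Num.max M 0); split; rewrite ?num_real// => t.
rewrite gt_max => /andP[Mt t0].
by rewrite sub0r normrN ger0_norm ?f0 ?hM// ltW.
Qed.

Lemma cvg0_eventually (u : nat -> R) (e : R) : u @ \oo --> (0 : R) -> 0 < e ->
  exists N, forall n, (N <= n)%N -> u n < e.
Proof.
move=> /cvgrPdist_lt h e0; have [N _ hN] := h _ e0; exists N => n /hN.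
by rewrite sub0r normrN; exact: le_lt_trans (ler_norm _).
Qed.

(** The samples [X_ n] of the pseudo orbit have defects [E n]; the correction [z] makes [X_ n + z n]
    a true orbit, and the local bound [C] controls the error between samples. *)
Lemma L_shadowing_of_bounded_solution (r K : R) : 0 < r -> 0 < K ->
    (forall E (B : R), (forall n, nrm (E n) <= B) ->
      (fun n => nrm (E n)) @ \oo --> (0 : R) ->
      exists z, [/\ forall n, nrm (z n) <= K * B,
        (fun n => nrm (z n)) @ \oo --> (0 : R) &
        forall n, z n.+1 = T r (z n) + E n]) ->
  L_shadowing ndist T.
Proof.
move=> r0 K0 hK eps eps0.
have [C C0 TC] := semigroup_bound hT r.
(* [D * delta] is the final error bound; the choice of [delta] makes it [eps / 2]. *)
pose D := C * (K * C) + C.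
have D0 : 0 < D by rewrite addr_gt0// !mulr_gt0.
pose delta := eps / D / 2.
have delta0 : 0 < delta by rewrite !divr_gt0.
exists delta, r; split=> // x_ t_ po jump0.
have rt i : r <= t_ i by have [] := po i.
have jd i : jump x_ t_ i < delta by have [] := po i.
have /choice[j hj] (n : nat) : exists i, time_index t_ (n%:R * r) i.
  by apply: (time_index_ex r0 rt); rewrite mulr_ge0// ltW.
pose X_ (n : nat) := star T x_ t_ (n%:R * r).
have track (n : nat) t : n%:R * r <= t <= n%:R * r + r ->
    nrm (T (t - n%:R * r) (X_ n) - star T x_ t_ t) <= C * jump x_ t_ (j n).
  exact: (star_step x_ r0 rt TC (hj n)).
(* The index [j n] of the sample time goes to infinity with [n], so the jumps met by the samples
   vanish. *)
have jumpj (e : R) : 0 < e -> exists N, forall n, (N <= n)%N ->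
    jump x_ t_ (j n) < e.
  move=> e0; have [N hN] := cvg0_eventually jump0 e0.
  exists (Num.bound (hat_time t_ N / r)) => n nN.
  apply: hN; apply: (hat_time_index r0 rt _ (hj n)).
  rewrite -ler_pdivrMr//.
  have h : 0 <= hat_time t_ N / r.
    apply: divr_ge0; last exact: ltW.
    by rewrite (le_trans _ (hat_time_ge rt N))// mulr_ge0// ltW.
  by rewrite (le_trans (ltW (archi_boundP h)))// ler_nat.
have jump_ge0 i : 0 <= jump x_ t_ i by exact: nrm_ge0.
pose E n := T r (X_ n) - X_ n.+1.
have EJ n : nrm (E n) <= C * jump x_ t_ (j n).
  have /track : n%:R * r <= n.+1%:R * r <= n%:R * r + r.
    by rewrite -natr1 mulrDl mul1r lexx lerDl ltW.
  by rewrite -{1}natr1 mulrDl mul1r addrAC subrr add0r.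
have [n||z [zB z0 zE]] := hK E (C * delta).
- by rewrite (le_trans (EJ n))// ler_pM2l// ltW.
- apply/cvgrPdist_lt => e e0; have [N hN] := jumpj _ (divr_gt0 e0 C0).
  exists N => // n /hN; rewrite ltr_pdivlMr// mulrC => jn.
  by rewrite sub0r normrN ger0_norm ?nrm_ge0// (le_lt_trans (EJ n)).
have orbit (n : nat) : T (n%:R * r) (X_ 0%N + z 0%N) = X_ n + z n.
  elim: n => [|n ih]; first by rewrite mul0r semigroup0.
  rewrite -natr1 mulrDl mul1r addrC.
  rewrite semigroupD ?ih ?mulr_ge0//; [|by rewrite ltW..].
  rewrite (linear_add (semigroup_linear hT (ltW r0))) zE.
  by rewrite [T r (z n) + _]addrC addrA [X_ n.+1 + _]addrC subrK.
have dist t : 0 <= t ->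
    ndist (T t (X_ 0%N + z 0%N)) (star T x_ t_ t) <=
    C * (nrm (z (Num.truncn (t / r))) + jump x_ t_ (j (Num.truncn (t / r)))).
  move=> t0; set n := Num.truncn _.
  have tr0 : 0 <= t / r by rewrite divr_ge0// ltW.
  have /andP[nt tn] : n%:R <= t / r < n.+1%:R by exact: truncn_itv.
  have {}nt : n%:R * r <= t by rewrite -ler_pdivlMr.
  have {}tn : t <= n%:R * r + r.
    by rewrite ltW// -[X in _ + X]mul1r -mulrDl natr1 -ltr_pdivrMr.
  have nr0 : 0 <= n%:R * r by rewrite mulr_ge0// ltW.
  have s0 : 0 <= t - n%:R * r by rewrite subr_ge0.
  rewrite -{1}(subrK (n%:R * r) t) semigroupD// orbit.
  rewrite (linear_add (semigroup_linear hT s0)) /ndist.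
  rewrite [_ (X_ n) + _]addrC -addrA.
  rewrite (le_trans (nrmD _ _))// mulrDr lerD ?TC ?track ?nt ?tn//.
  by rewrite s0/=; lra.
exists (X_ 0%N + z 0%N), id; split; first exact: increasing_homeomorphism_id.
  move=> t t0; rewrite (le_lt_trans (dist t t0))//.
  set n := Num.truncn _.
  have h : nrm (z n) + jump x_ t_ (j n) <= K * (C * delta) + delta.
    by rewrite lerD// ltW.
  rewrite (le_lt_trans (ler_wpM2l (ltW C0) h))//.
  have -> : C * (K * (C * delta) + delta) = D * delta by rewrite /D; ring.
  by rewrite /delta mulrA mulrCA mulfV ?gt_eqF// mulr1; lra.
apply: near_infty_eventually => [t _|e e0]; first exact: nrm_ge0.
have e20 : 0 < e / C / 2 by rewrite !divr_gt0.
have [N1 h1] := cvg0_eventually z0 e20.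
have [N2 h2] := jumpj _ e20.
exists ((maxn N1 N2)%:R * r) => t t0 Nt.
rewrite (le_lt_trans (dist t t0))//.
set n := Num.truncn _.
have : (maxn N1 N2 <= n)%N.
  by rewrite (truncn_ge_nat _ (divr_ge0 t0 (ltW r0))) ler_pdivlMr.
rewrite geq_max => /andP[/h1 z1 /h2 j2].
by rewrite mulrC -ltr_pdivlMr// [ltRHS]splitr ltrD.
Qed.

(** The estimate at the point 1 after [n] squarings comes from estimates at the [2 ^ n]-th roots of
    unity, hence the bound [e0] over the whole circle at time 1. *)
Lemma small_resolvent_at_time : hyperbolic T -> exists n : nat,
  small_at (T (2 ^+ n)) 1 8^-1.
Proof.
move=> hyp.
pose Tn n := T (2 ^+ n).
have T1 : bounded_linear (T 1) by exact: (semigroup_bounded_linear hT).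
have res t : exists S, resolvent_op (T 1) (cis t) S.
  apply: contrapT => h.
  have : (spectrum (T 1) `&` unit_circle) (cis t).
    by split; [|exact: norm_cis].
  by rewrite hyp.
have [M hM] := resolvent_uniform_bound 0 (pi + pi) res.
have [M1 M10 T1M] := bounded_linear_gt0 T1.
pose e0 := M1 * (`|M| * `|M|).
have e0_ge0 : 0 <= e0 by rewrite !mulr_ge0// ltW.
have base t : 0 <= t <= pi + pi -> small_at (Tn 0%N) (cis t) e0.
  move=> /hM[S Sres SM]; exists S => [|x]; first by rewrite /Tn expr0.
  have SM' y : nrm (S y) <= `|M| * nrm y.
    by rewrite (le_trans (SM y))// ler_wpM2r ?nrm_ge0// ler_norm.
  rewrite /Tn expr0 (le_trans (T1M _))// /e0 -!mulrA ler_pM2l//.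
  by rewrite (le_trans (SM' _))// ler_wpM2l.
have [n nP] : exists n : nat, e0 * 8 < 2 ^+ n.
  exists (Num.bound (e0 * 8)).
  rewrite (lt_trans (archi_boundP (mulr_ge0 e0_ge0 (ler0n _ 8))))//.
  by rewrite -natrX ltr_nat ltn_expl.
exists n.
have Tnl k : linear (Tn k) by apply: (semigroup_linear hT); rewrite exprn_ge0.
have TnS k x : Tn k.+1 x = Tn k (Tn k x).
  by rewrite /Tn exprS mulr_natl mulr2n (semigroupD hT)// exprn_ge0.
have t0 : 0 <= (0 : R) <= pi + pi by rewrite lexx addr_ge0// pi_ge0.
have [S Sres Ssmall] := small_at_dyadic n Tnl TnS base t0.
exists S; first by rewrite -(@cis0 R).
move=> x; rewrite (le_trans (Ssmall x))// ler_wpM2r ?nrm_ge0//.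
by rewrite ler_pdivrMr ?exprn_gt0// mulrC ler_pdivlMr// ltW.
Qed.

Lemma hyperbolic_L_shadowing : hyperbolic T -> L_shadowing ndist T.
Proof.
move=> /small_resolvent_at_time[n [S Sres Ssmall]].
have n0 : 0 < 2 ^+ n :> R by rewrite exprn_gt0.
have [K K0 hK] := bounded_solution (semigroup_linear hT (ltW n0)) Sres Ssmall.
exact: (L_shadowing_of_bounded_solution n0 K0 hK).
Qed.

End Shadowing.

(** * Polynomials in a linear map *)

Section PolyCalculus.
Context {K : fieldType} {V : lmodType K} (f : V -> V).
Hypothesis fl : linear f.
Implicit Types p q : {poly K}.

Definition polyop p (x : V) : V := \sum_(i < size p) p`_i *: iter i f x.

Lemma polyop_wide n p x : (size p <= n)%N ->
  polyop p x = \sum_(i < n) p`_i *: iter i f x.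
Proof.
move=> pn; rewrite /polyop (big_ord_widen n (fun i => p`_i *: iter i f x))//.
rewrite big_mkcond; apply: eq_bigr => i _; case: ltnP => // /(nth_default 0) ->.
by rewrite scale0r.
Qed.

Lemma polyopD p q x : polyop (p + q) x = polyop p x + polyop q x.
Proof.
rewrite (polyop_wide _ (size_polyD p q)) (polyop_wide _ (leq_maxl _ (size q))).
rewrite [polyop q x](polyop_wide _ (leq_maxr (size p) _)) -big_split/=.
by apply: eq_bigr => i _; rewrite coefD scalerDl.
Qed.

Lemma polyopZ c p x : polyop (c *: p) x = c *: polyop p x.
Proof.
rewrite (polyop_wide _ (size_scale_leq c p)) scaler_sumr.
by apply: eq_bigr => i _; rewrite coefZ scalerA.
Qed.

Lemma polyopC c x : polyop c%:P x = c *: x.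
Proof. by rewrite (polyop_wide _ (size_polyC_leq1 c)) big_ord1 coefC. Qed.

Lemma polyopMX p x : polyop (p * 'X) x = polyop p (f x).
Proof.
have sp : (size (p * 'X)%R <= (size p).+1)%N.
  by rewrite (leq_trans (size_polyMleq _ _))// size_polyX addn2.
rewrite (polyop_wide _ sp) big_ord_recl coefMX eqxx scale0r add0r.
by apply: eq_bigr => i _; rewrite coefMX/= -iterSr.
Qed.

Lemma polyop_comm p x : polyop p (f x) = f (polyop p x).
Proof.
elim/poly_ind: p x => [|p c ih] x.
  by rewrite !polyopC !scale0r (linear_zero fl).
by rewrite !polyopD !polyopMX !polyopC ih (linear_add fl) (linear_scale fl) ih.
Qed.

Lemma polyopM p q x : polyop (p * q) x = polyop p (polyop q x).
Proof.
elim/poly_ind: p x => [|p c ih] x; first by rewrite mul0r !polyopC !scale0r.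
rewrite mulrDl mulrAC mul_polyC !polyopD !polyopMX polyopZ polyopC ih.
by rewrite polyop_comm.
Qed.

Lemma polyop_linear p : linear (polyop p).
Proof.
elim/poly_ind: p => [|p c ih] a u v.
  by rewrite !polyopC !scale0r scaler0 addr0.
rewrite !polyopD !polyopMX !polyopC fl ih !scalerDr !scalerA addrACA.
by rewrite (mulrC a c).
Qed.

Lemma polyop_XsubC a x : polyop ('X - a%:P) x = f x - a *: x.
Proof.
rewrite -polyCN polyopD polyopC scaleNr; congr (_ + _).
by rewrite -['X]mul1r polyopMX polyopC scale1r.
Qed.

Lemma poly_eval_decomp p a : exists q, p = q * ('X - a%:P) + p.[a]%:P.
Proof.
have /factor_theorem[q pq] : root (p - p.[a]%:P) a.
  by rewrite rootE hornerD hornerN hornerC subrr.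
by exists q; rewrite -pq subrK.
Qed.

Lemma polyop_eigen p a v : f v = a *: v -> polyop p v = p.[a] *: v.
Proof.
move=> fv; have [q {1}->] := poly_eval_decomp p a.
rewrite polyopD polyopM polyop_XsubC fv subrr polyopC.
by rewrite (linear_zero (polyop_linear q)) add0r.
Qed.

Lemma polyop_iter p i x : polyop p (iter i f x) = iter i f (polyop p x).
Proof. by elim: i => //= i ih; rewrite polyop_comm ih. Qed.

(** The spanning family may be dependent, so [C] is just some matrix lifting [f] through the
    surjection [E]; Cayley-Hamilton for [C] descends along [E]. *)
Lemma annihilator : finite_dimensional V ->
  exists2 p, p != 0 & forall x, polyop p x = 0.
Proof.
move=> [[|n] [e eP]].
  (* An empty family leaves only the zero space, which 1 annihilates; the matrices below have
     positive size. *)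
  exists 1; first exact: oner_neq0.
  by move=> x; have [c ->] := eP x; rewrite big_ord0 polyopC scaler0.
have /choice[c cP] i := eP (f (e i)).
pose C := \matrix_(i, j) c i j.
pose E (v : 'rV[K]_n.+1) := \sum_i v 0 i *: e i.
have EC v : E (v *m C) = f (E v).
  have -> : f (E v) = \sum_i v 0 i *: f (e i).
    rewrite /E (big_morph f (linear_add fl) (linear_zero fl)).
    by apply: eq_bigr => i _; rewrite (linear_scale fl).
  under [RHS]eq_bigr do rewrite cP scaler_sumr.
  rewrite exchange_big/=; apply: eq_bigr => j _.
  rewrite !mxE scaler_suml; apply: eq_bigr => i _.
  by rewrite mxE scalerA.
have Ehorner p v : E (v *m horner_mx C p) = polyop p (E v).
  elim/poly_ind: p => [|p a ih].
    rewrite rmorph0 mulmx0 polyopC scale0r /E big1// => i _.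
    by rewrite mxE scale0r.
  rewrite polyopD polyopMX polyop_comm polyopC -ih -EC.
  rewrite rmorphD rmorphM/= horner_mx_X horner_mx_C mulmxDr mul_mx_scalar.
  rewrite -[_ * C]/(_ *m C) mulmxA /E scaler_sumr -big_split/=.
  by apply: eq_bigr => i _; rewrite !mxE scalerDl scalerA.
exists (char_poly C); first exact/monic_neq0/char_poly_monic.
move=> x; have [d ->] := eP x.
have -> : \sum_i d i *: e i = E (\row_i d i).
  by apply: eq_bigr => i _; rewrite mxE.
rewrite -Ehorner Cayley_Hamilton mulmx0 /E big1// => i _.
by rewrite mxE scale0r.
Qed.

(** Split off the multiplicity of [a]: [polyop q] maps into the generalized eigenspace of [a], yet
    multiplies eigenvectors for [a] by the nonzero [q.[a]]. *)
Lemma annihilator_coprime a : finite_dimensional V -> exists m q,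
  q.[a] != 0 /\ forall x, polyop (('X - a%:P) ^+ m) (polyop q x) = 0.
Proof.
move=> /annihilator[p p0 pP]; have [m [q qa pE]] := multiplicity_XsubC p a.
exists m, q; split=> [|x]; first by move: qa; rewrite p0.
by rewrite -polyopM mulrC -pE.
Qed.

End PolyCalculus.

(** * Eigenvectors and slowly drifting orbits in finite dimension *)

Section Eigenvector.
Context {R : realType} {X : normedModType R[i]} (f : X -> X).
Hypothesis fb : bounded_linear f.
Let fl : linear f. Proof. by case: fb. Qed.

Lemma polyop_bounded p : bounded_linear (polyop f p).
Proof.
elim/poly_ind: p => [|p c ih].
  rewrite (_ : polyop f 0 = fun=> 0); first exact: bounded_linear_zero.
  by apply/funext => x; rewrite polyopC scale0r.
rewrite (_ : polyop f _ = fun x => polyop f p (f x) + c *: x).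
  apply: bounded_linear_scaleDr; last exact: bounded_linear_id.
  exact: bounded_linear_comp.
by apply/funext => x; rewrite polyopD polyopMX polyopC.
Qed.

(** If [f - l] is injective, its powers cancel and [q] itself annihilates. Dividing [q] by [X - l],
    with quotient [r], exhibits [- r(f) / q(l)] as the inverse, bounded because it is polynomial in
    [f]. *)
Lemma spectrum_eigenvector l : finite_dimensional X -> spectrum f l ->
  exists2 v, v <> 0 & f v = l *: v.
Proof.
move=> fd; apply: contra_notP => noev.
have inj y : f y - l *: y = 0 -> y = 0.
  by move=> /subr0_eq fy; apply: contrapT => y0; apply: noev; exists y.
have [m [q [ql qP]]] := annihilator_coprime fl l fd.
have injm k y : polyop f (('X - l%:P) ^+ k) y = 0 -> y = 0.
  elim: k y => [|k ih] y; first by rewrite expr0 polyopC scale1r.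
  by rewrite exprSr polyopM// polyop_XsubC => /ih/inj.
have [r qE] := poly_eval_decomp q l.
have rP x : polyop f r (f x - l *: x) + q.[l] *: x = 0.
  rewrite -polyop_XsubC -polyopM// -(polyopC f) -polyopD -qE.
  exact: injm (qP x).
have sol x : - q.[l]^-1 *: polyop f r (f x - l *: x) = x.
  by rewrite scaleNr -scalerN (addr0_eq (rP x)) scalerA mulVf// scale1r.
(* The summand 0 gives the witness the shape expected by [bounded_linear_scaleDr]. *)
exists (fun x => 0 + - q.[l]^-1 *: polyop f r x); split => [|x|x].
- by apply: bounded_linear_scaleDr (polyop_bounded r);
    exact: bounded_linear_zero.
- by rewrite add0r sol.
- rewrite add0r (linear_scale fl) scalerA mulrC -scalerA -scalerBr.
  rewrite -polyop_comm// -(linear_scale (polyop_linear fl r)).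
  by rewrite -(linear_sub (polyop_linear fl r)) sol.
Qed.

Lemma iter_linear i : linear (iter i f).
Proof. by elim: i => [|i ih] a u v //=; rewrite ih fl. Qed.

(** By induction [f u - u], of lower exponent and with vanishing orbit, is 0; then the orbit of [u]
    is constant and tends to 0. *)
Lemma cvg0_unipotent k u : polyop f (('X - 1%:P) ^+ k) u = 0 ->
  (fun i => nrm (iter i f u)) @ \oo --> (0 : R) -> u = 0.
Proof.
elim: k u => [|k ih] u; first by rewrite expr0 polyopC scale1r.
rewrite exprSr polyopM// polyop_XsubC scale1r => /ih uk u0.
have /subr0_eq fu : f u - u = 0.
  apply: uk; apply: (@cvg0_le _ _
      (fun i => nrm (iter i.+1 f u) + nrm (iter i f u))).
    move=> i; rewrite nrm_ge0 (linear_sub (iter_linear i)).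
    by rewrite iterSr nrmB.
  rewrite -[X in _ --> X]addr0; apply: cvgD => //.
  by rewrite (cvg_shiftS (fun i => nrm (iter i f u))).
apply: (@nrm_small _ _ _ 1) => e e0.
have [N /(_ N (leqnn N))] := cvg0_eventually u0 e0.
have -> : iter N f u = u by elim: N => //= N ->.
by rewrite mul1r => /ltW.
Qed.

(** [y = q(f) x] lies in the unipotent part and its orbit follows [b i * c] times [v]. As the
    increments of [b] vanish, so does the orbit of [f y - y]; hence [y] is fixed, and [b] stays
    bounded. *)
Lemma slow_drift_bounded (v x : X) (b : nat -> R) : finite_dimensional X ->
    v <> 0 -> f v = v -> (fun i => b i.+1 - b i) @ \oo --> (0 : R) ->
    (fun i => nrm (iter i f x - (b i)%:C *: v)) @ \oo --> (0 : R) ->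
  exists M, \forall i \near \oo, `|b i| <= M.
Proof.
move=> fd v0 fv db xb.
have [m [q [q1 qP]]] := annihilator_coprime fl 1 fd.
set y := polyop f q x; pose c := q.[1].
have [Q Q0 QP] := bounded_linear_gt0 (polyop_bounded q).
have qv : polyop f q v = c *: v by apply: polyop_eigen => //; rewrite scale1r.
pose d i := iter i f y - ((b i)%:C * c) *: v.
have d0 : (fun i => nrm (d i)) @ \oo --> (0 : R).
  apply: (@cvg0_le _ _ (fun i => Q * nrm (iter i f x - (b i)%:C *: v))).
    move=> i; rewrite nrm_ge0 /d -scalerA -qv.
    rewrite -polyop_iter// -(linear_scale (polyop_linear fl q)).
    by rewrite -(linear_sub (polyop_linear fl q)) QP.
  by rewrite -[X in _ --> X](mulr0 Q); exact: cvgMl_tmp.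
have fy : f y = y.
  apply: subr0_eq; apply: (@cvg0_unipotent m).
    rewrite (linear_sub (polyop_linear fl _)) polyop_comm// qP.
    by rewrite (linear_zero fl) subr0.
  apply: (@cvg0_le _ _ (fun i => nrm (d i.+1) + nrm (d i) +
      `|b i.+1 - b i| * nrm (c *: v))).
    move=> i; rewrite nrm_ge0 (linear_sub (iter_linear i)) -iterSr.
    have -> : iter i.+1 f y - iter i f y =
        d i.+1 - d i + (b i.+1 - b i)%:C *: (c *: v).
      rewrite /d !scalerA rmorphB/= mulrBl scalerBl opprB.
      move: (iter i.+1 f y) (iter i f y) => y1 y0.
      by rewrite !addrA [RHS](ACl (1*4*2*5*3*6)) /= addrK subrK.
    by rewrite (le_trans (nrmD _ _))// nrmZr lerD2r nrmB.
  rewrite -[X in _ --> X]addr0 -[X in _ --> X + _]addr0.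
  apply: cvgD; first apply: cvgD => //.
    by rewrite (cvg_shiftS (fun i => nrm (d i))).
  rewrite -[X in _ --> X](mul0r (nrm (c *: v))).
  by apply: cvgMr_tmp; rewrite -[X in _ --> X](normr0 R); exact: cvg_norm.
have fyi i : iter i f y = y by elim: i => //= i ->.
have cv0 : 0 < nrm (c *: v).
  rewrite lt0r nrm_ge0 andbT; apply/eqP => /nrm0_eq0/eqP.
  by rewrite scaler_eq0 (negbTE q1)/= => /eqP.
exists ((nrm y + 1) / nrm (c *: v)).
have [N hN] := cvg0_eventually d0 ltr01.
exists N => // i /= /hN di; rewrite ler_pdivlMr// -nrmZr.
have -> : (b i)%:C *: (c *: v) = y - d i.
  by rewrite /d fyi scalerA opprB addrC subrK.
by rewrite (le_trans (nrmB _ _))// lerD2l ltW.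
Qed.

End Eigenvector.

(** * From L-shadowing to hyperbolicity *)

Section Converse.
Context {R : realType} {X : completeNormedModType R[i]}.
Context {T : R -> X -> X}.
Hypothesis hT : C0_semigroup T.

Lemma semigroup_eigen l v n : T 1 v = l *: v -> T n%:R v = l ^+ n *: v.
Proof.
move=> Tv; elim: n => [|n ih]; first by rewrite (semigroup0 hT) expr0 scale1r.
rewrite -natr1 (semigroupD hT)// Tv (linear_scale (semigroup_linear hT _))//.
by rewrite ih scalerA exprS.
Qed.

Lemma L_shadowing_hyperbolic : finite_dimensional X -> L_shadowing ndist T ->
  hyperbolic T.
Proof.
move=> fd sh; apply/seteqP; split=> [l [lspec l1]|//].
have T1 : bounded_linear (T 1) by exact: (semigroup_bounded_linear hT).
have [v v0 Tv] := spectrum_eigenvector T1 fd lspec.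
have {}l1 : `|l| = 1 by exact: l1.
have nv0 : 0 < nrm v.
  by rewrite lt0r nrm_ge0 andbT; apply/eqP => /nrm0_eq0.
have [delta [r [delta0 r0 hsh]]] := sh 1 ltr01.
(* A natural time step above [r], so that [T N] multiplies [v] by [mu]. *)
pose N := (Num.bound r).
have rN : r < N%:R by apply: archi_boundP; exact: ltW.
have N0 : 0 < N%:R :> R by exact: lt_trans rN.
pose mu := l ^+ N.
have mu1 i : `|mu ^+ i| = 1 by rewrite normrX normrX l1 !expr1n.
have mu0 : mu != 0 by rewrite -normr_eq0 -[mu]expr1 mu1 oner_neq0.
(* This scale makes the jump at [i] equal to [delta / 2 * harmonic i]. *)
pose c := delta / 2 / nrm v.
have c0 : 0 < c by rewrite !divr_gt0.
pose b i : R := c * series harmonic i.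
have bS i : b i.+1 - b i = c * harmonic i.
  by rewrite /b -mulrBr seriesSB.
pose x_ i := (mu ^+ i * (b i)%:C) *: v.
have TN : linear (T N%:R) by exact: (semigroup_linear hT).
have jumpE i : ndist (T N%:R (x_ i)) (x_ i.+1) = delta / 2 * harmonic i.
  rewrite /ndist (linear_scale TN) (semigroup_eigen _ Tv) -/mu scalerA /x_.
  rewrite -scalerBl.
  have -> : mu ^+ i * (b i)%:C * mu - mu ^+ i.+1 * (b i.+1)%:C =
      mu ^+ i.+1 * (b i - b i.+1)%:C by rewrite rmorphB/= exprS; ring.
  rewrite -scalerA nrm_unitZ// nrmZr -opprB normrN bS ger0_norm; last first.
    by apply: mulr_ge0; apply: ltW => //; exact: harmonic_gt0.
  by rewrite /c mulrAC divfK ?gt_eqF.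
have po : pseudo_orbit ndist T delta r x_ (fun=> N%:R).
  move=> i; split=> //; first exact: ltW.
  rewrite jumpE /harmonic -mulrA gtr_pMr// -invfM invf_lt1 ?mulr_gt0//.
  by rewrite -natrM ltr1n mulnS.
have harm0 (a : R) : (fun i => a * harmonic i) @ \oo --> (0 : R).
  by rewrite -[X in _ --> X](mulr0 a); apply: cvgMl_tmp; exact: cvg_harmonic.
have jump0 : ndist (T N%:R (x_ i)) (x_ i.+1) @[i --> \oo] --> (0 : R).
  by under eq_cvg do rewrite jumpE; exact: harm0.
have [x [_ [_ _ xlim]]] := hsh x_ (fun=> N%:R) po jump0.
(* This rescaling of [T N] fixes [v], and turns following [x_ i] into following [b i] times [v]. *)
pose f (y : X) : X := 0 + mu^-1 *: T N%:R y.
have fb : bounded_linear f.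
  apply: bounded_linear_scaleDr; first exact: bounded_linear_zero.
  exact: (semigroup_bounded_linear hT).
have fv : f v = v.
  by rewrite /f add0r (semigroup_eigen _ Tv) scalerA mulVf// scale1r.
have fi i : iter i f x = mu ^- i *: T (i%:R * N%:R) x.
  elim: i => [|i ih].
    by rewrite mul0r (semigroup0 hT) expr0 invr1 scale1r.
  rewrite iterS ih /f add0r (linear_scale TN) scalerA -invfM -exprS.
  by rewrite -(semigroupD hT)// ?mulr_ge0// -natr1 mulrDl mul1r addrC.
have hat i : hat_time (fun=> N%:R : R) i = i%:R * N%:R.
  by rewrite /hat_time sumr_const_nat subn0 mulr_natl.
have star_x i : star T x_ (fun=> N%:R) (i%:R * N%:R) = x_ i.
  have ti : time_index (fun=> N%:R) (i%:R * N%:R : R) i.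
    by rewrite /time_index !hat lexx ltr_pM2r// ltr_nat ltnSn.
  by rewrite (starE N0 (fun=> lexx _) T x_ ti) hat subrr (semigroup0 hT).
have drift : (fun i => nrm (iter i f x - (b i)%:C *: v)) @ \oo --> (0 : R).
  apply/cvgrPdist_lt => e e0.
  have [M [_ hM]] : \forall t \near +oo,
      `|0 - ndist (T t x) (star T x_ (fun=> N%:R) t)| < e.
    by move/cvgrPdist_lt: xlim; exact.
  near=> i.
  have : M < i%:R * N%:R.
    rewrite -ltr_pdivrMr//; near: i; exact: nbhs_infty_gtr.
  move=> /hM; rewrite !sub0r !normrN !ger0_norm ?nrm_ge0// star_x /ndist.
  have -> : T (i%:R * N%:R) x - x_ i =
      mu ^+ i *: (iter i f x - (b i)%:C *: v).
    by rewrite fi scalerBr !scalerA (mulfV (expf_neq0 i mu0)) scale1r.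
  by rewrite nrm_unitZ.
have db : (fun i => b i.+1 - b i) @ \oo --> (0 : R).
  by under eq_cvg do rewrite bS; exact: harm0.
have [M [n _ bM]] := slow_drift_bounded fb fd v0 fv db drift.
(* A bound on [b] from rank [n] on bounds, by monotonicity, all partial sums of the harmonic series,
   which would then converge. *)
apply: (@dvg_harmonic R); apply: nondecreasing_is_cvgn.
  apply/nondecreasing_seqP => i; rewrite -subr_ge0 seriesSB.
  by rewrite ltW// harmonic_gt0.
exists (M / c) => _ [i _ <-].
have /bM : (n <= maxn n i)%N by rewrite leq_maxl.
rewrite /b normrM gtr0_norm// mulrC -ler_pdivlMr// => h.
rewrite (le_trans _ h)// (le_trans _ (ler_norm _))//.
apply: (nondecreasing_series (u_ := harmonic) (P := xpredT)).
  by move=> k _ _; rewrite ltW// harmonic_gt0.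
exact: leq_maxr.
Unshelve. all: by end_near. Qed.

End Converse.

Theorem mainTheorem1 (R : realType) (X : completeNormedModType R[i])
    (T : R -> X -> X) (DA : set X) (A : DA -> X)
    (hT : C0_semigroup T) (hA : infinitesimal_generator T A) :
  (hyperbolic T -> L_shadowing ndist T) /\
  (finite_dimensional X -> L_shadowing ndist T -> hyperbolic T).
Proof.
by split; [exact: hyperbolic_L_shadowing|exact: L_shadowing_hyperbolic].
Qed.
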